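(* For $n\ge 1$ let $\sigma$ be an $n$-simplex of the triangulation of $\mathcal K^n$ described in the context, determined either by (1) an $(n-1)$-simplex $\omega$ of $\mathcal K^{n-1}$, or by (2) a triple $(a,p,q)$ with $1\le a\le p+1$, $p\ge1$, $q\ge 0$, $p+q=n-1$ (determining a face $\mathcal K^p\times\mathcal K^q$ of $\mathcal K^n$), a $p$-simplex $\alpha$ of $\mathcal K^p$, a $q$-simplex $\beta$ of $\mathcal K^q$ and a $(p,q)$-shuffle $\theta$. Define $\Phi_n$ recursively (with $\Phi_0$ sending the unique $0$-simplex of $\mathcal K^0$ to the empty sequence) by $$\Phi_n(\sigma):=\bigl(1,\ 1+\Phi_{n-1}(\omega)\bigr)\quad\text{in case (1)},$$ $$\Phi_n(\sigma):=\bigl(a,\ \theta_*(\Phi_p(\alpha),\ p+1+\Phi_q(\beta))\bigr)\quad\text{in case (2)}.$$ Then $\Phi_n$ is a bijection from the set of $n$-simplices of the triangulation of $\mathcal K^n$ to the set $PF_n$ of parking functions of length $n$.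
   Context: Parking functions. A parking function of length $n$ is a sequence of integers $(i_1,\dots,i_n)$ whose nondecreasing rearrangement $j_1\le\cdots\le j_n$ satisfies $1\le j_k\le k$ for all $k$; $PF_n$ is the set of these. For a sequence $u=(u_1,\dots,u_m)$ and an integer $c$, $c+u=(c+u_1,\dots,c+u_m)$; $(a,u)$ is $u$ with $a$ put in front; $(u,v)$ is concatenation. Shuffles. A $(p,q)$-shuffle is a permutation written as a word $\theta(1)\cdots\theta(p+q)$ in the letters $1,\dots,p+q$ in which $1,\dots,p$ appear in increasing order and $p+1,\dots,p+q$ appear in increasing order. $\theta_*(w_1,\dots,w_{p+q})=(w_{\theta(1)},\dots,w_{\theta(p+q)})$. Trees and associahedron. $Y_m$ is the set of planar binary rooted trees with $m$ internal vertices ($m+1$ leaves). For $t\in Y_m$, $m\ge1$, number the leaves $0,\dots,m$ from left to right and the internal vertices $1,\dots,m$ so that vertex $i$ lies between leaves $i-1$ and $i$. Let $a_i$ (resp. $b_i$) be the number of descendant leaves of vertex $i$ on its left (resp. right) side, and $M(t)=(a_1b_1,\dots,a_mb_m)\in\mathbb R^m$. The associahedron $\mathcal K^n$ is the convex hull of the points $M(t)$, $t\in Y_{n+1}$; it is an $n$-dimensional polytope with vertices $M(t)$, identified with $t\in Y_{n+1}$. The Tamari order on $Y_m$ has as covering relations the local replacements of a subtree of shape $(xy)z$ by $x(yz)$; its maximum is the right comb (every left child is a leaf). The South pole $S$ of $\mathcal K^n$ is the vertex corresponding to the right comb in $Y_{n+1}$. Cells. For $p,q\ge0$, $p+q=n-1$,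 $0\le a\le p+1$, $\gamma(a;p,q)$ denotes the facet of $\mathcal K^n$ whose vertices are the trees obtained from pairs $(t,s)\in Y_{p+1}\times Y_{q+1}$ by grafting the root of $s$ on the leaf of $t$ of index $a$, leaves of $t$ being counted from right to left starting at $0$. In this way it is identified with $\mathcal K^p\times\mathcal K^q$; in particular $\gamma(1;0,n-1)$ is identified with $\mathcal K^{n-1}$. Triangulation. Simplices are oriented, i.e. have totally ordered vertices, increasing for the Tamari order. $\mathcal K^0$ is a point. For $n\ge1$ the $n$-simplices of $\mathcal K^n$ are the cones with apex $S$ (as last vertex) over the following $(n-1)$-simplices: (1) an $(n-1)$-simplex $\omega$ of $\mathcal K^{n-1}$, identified with $\gamma(1;0,n-1)$; (2) for $p\ge1$, $q\ge 0$, $p+q=n-1$, $1\le a\le p+1$, in $\gamma(a;p,q)\cong\mathcal K^p\times\mathcal K^q$, the $(n-1)$-simplex determined by a $p$-simplex $\alpha$ of $\mathcal K^p$ with vertices $v_0,\dots,v_p$, a $q$-simplex $\beta$ of $\mathcal K^q$ with vertices $w_0,\dots,w_q$ and a $(p,q)$-shuffle $\theta$: its successive vertices are the points $(v_i,w_j)$ obtained by starting at $(v_0,w_0)$ and, at the $k$th step, increasing $i$ by $1$ if $\theta(k)\le p$ and increasing $j$ by $1$ if $\theta(k)>p$. Each $n$-simplex is given by a unique such choice. *)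

(* Defs.v *)
From mathcomp Require Import all_boot.
From mathcomp Require Import classical_sets functions.
From Stdlib Require Import Relation_Operators.

Set Implicit Arguments.
Unset Strict Implicit.
Unset Printing Implicit Defensive.

Local Open Scope classical_set_scope.
Local Open Scope nat_scope.

Definition parking n (u : seq nat) : Prop :=
  size u = n /\
  forall k, k < n -> 1 <= nth 0 (sort leq u) k <= k.+1.

Definition PF n : set (seq nat) := [set u | parking n u].

(* A (p,q)-shuffle is the word theta(1) ... theta(p+q); its letters count
   from 1. *)
Definition shuffle p q (theta : seq nat) : Prop :=
  [/\ perm_eq theta (iota 1 (p + q)),
      sorted ltn [seq x <- theta | x <= p] &
      sorted ltn [seq x <- theta | p < x]].

Definition shuffle_act (theta w : seq nat) : seq nat :=
  [seq nth 0 w k.-1 | k <- theta].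

Inductive tree := Leaf | Node of tree & tree.

Fixpoint nodes t := if t is Node l r then (nodes l + nodes r).+1 else 0.

Fixpoint leaves t := if t is Node l r then leaves l + leaves r else 1.

(* The elements of Y n.+1 stand for the vertices of the associahedron K^n. *)
Definition Y m : set tree := [set t | nodes t = m].

Inductive tamari_cover : tree -> tree -> Prop :=
| tamari_rot x y z : tamari_cover (Node (Node x y) z) (Node x (Node y z))
| tamari_left l l' r :
    tamari_cover l l' -> tamari_cover (Node l r) (Node l' r)
| tamari_right l r r' :
    tamari_cover r r' -> tamari_cover (Node l r) (Node l r').

Definition tamari_lt : tree -> tree -> Prop := clos_trans tree tamari_cover.

Fixpoint right_comb m := if m is m'.+1 then Node Leaf (right_comb m') else Leaf.

Definition south_pole n := right_comb n.+1.

(* Grafts the root of s on the leaf of t of index a, the leaves of t being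
   counted from right to left from 0. Only meaningful for a < leaves t. *)
Fixpoint graft t a s :=
  if t is Node l r then
    if a < leaves r then Node l (graft r a s)
    else Node (graft l (a - leaves r) s) r
  else s.

Definition cherry := Node Leaf Leaf.

(* The facet gamma(a;p,q) of K^(p + q + 1) has as vertices the trees
   graft t a s with t in Y p.+1 and s in Y q.+1, so that graft _ a _ is the
   identification K^p x K^q = gamma(a;p,q). After k steps of theta the path is
   at (v_i, w_j), where i (resp. j) is the number of letters <= p (resp. > p)
   among the first k letters of theta. *)
Definition product_simplex a p (alpha beta : seq tree) (theta : seq nat)
    : seq tree :=
  [seq graft (nth Leaf alpha (count (fun x => x <= p) (take k theta))) a
             (nth Leaf beta (count (fun x => p < x) (take k theta)))
  | k <- iota 0 (size theta).+1].

Definition cone n (s : seq tree) : seq tree := rcons s (south_pole n).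

(* simplex n s : s is the sequence of the vertices, in order, of an n-simplex
   of the triangulation of K^n. In case 1, graft cherry 1 identifies K^n with
   the facet gamma(1;0,n) of K^(n + 1). *)
Inductive simplex : nat -> seq tree -> Prop :=
| simplex_point : simplex 0 [:: cherry]
| simplex_case1 n omega :
    simplex n omega ->
    simplex n.+1 (cone n.+1 [seq graft cherry 1 w | w <- omega])
| simplex_case2 a p q alpha beta theta :
    1 <= p -> 1 <= a <= p.+1 ->
    simplex p alpha -> simplex q beta -> shuffle p q theta ->
    simplex (p + q).+1
            (cone (p + q).+1 (product_simplex a p alpha beta theta)).

Definition triangulation n : set (seq tree) := [set s | simplex n s].

Record Phi_recursion (Phi : nat -> seq tree -> seq nat) : Prop := {
  Phi_point : Phi 0 [:: cherry] = [::] ;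
  Phi_case1 : forall n omega,
    simplex n omega ->
    Phi n.+1 (cone n.+1 [seq graft cherry 1 w | w <- omega])
    = 1 :: [seq 1 + x | x <- Phi n omega] ;
  Phi_case2 : forall a p q alpha beta theta,
    1 <= p -> 1 <= a <= p.+1 ->
    simplex p alpha -> simplex q beta -> shuffle p q theta ->
    Phi (p + q).+1 (cone (p + q).+1 (product_simplex a p alpha beta theta))
    = a :: shuffle_act theta
             (Phi p alpha ++ [seq p + 1 + x | x <- Phi q beta])
}.

(* Sanity check: every element of triangulation n is a sequence of n + 1
   vertices of K^n, strictly increasing for the Tamari order. *)

Definition tamari_chain n : set (seq tree) :=
  [set s | [/\ size s = n.+1,
               forall i, i < n.+1 -> Y n.+1 (nth Leaf s i) &
               forall i, i < n ->
                 tamari_lt (nth Leaf s i) (nth Leaf s i.+1)]].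

Lemma leavesE t : leaves t = (nodes t).+1.
Proof. by elim: t => //= l -> r ->; rewrite addSn addnS. Qed.

Lemma nodes_graft t a s : nodes (graft t a s) = nodes t + nodes s.
Proof.
elim: t a => //= l IHl r IHr a.
case: ifP => _ /=; first by rewrite IHr addSn addnA.
by rewrite IHl addSn addnAC.
Qed.

Lemma nodes_right_comb m : nodes (right_comb m) = m.
Proof. by elim: m => //= m ->. Qed.

Lemma tamari_lt_left l l' r :
  tamari_lt l l' -> tamari_lt (Node l r) (Node l' r).
Proof.
elim=> [x y xy|x y z _ xy _ yz]; first exact/t_step/tamari_left.
exact: t_trans xy yz.
Qed.

Lemma tamari_lt_right l r r' :
  tamari_lt r r' -> tamari_lt (Node l r) (Node l r').
Proof.
elim=> [x y xy|x y z _ xy _ yz]; first exact/t_step/tamari_right.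
exact: t_trans xy yz.
Qed.

Lemma tamari_cover_nodes x y : tamari_cover x y -> nodes x = nodes y.
Proof.
elim=> [u v w|l l' r _|l r r' _] /=; [|by move=> ->..].
by rewrite addSn addnS addnA.
Qed.

Lemma tamari_lt_graftr t a s s' :
  tamari_lt s s' -> tamari_lt (graft t a s) (graft t a s').
Proof.
move=> ss'; elim: t a => //= l IHl r IHr a.
by case: ifP => _; [exact: tamari_lt_right | exact: tamari_lt_left].
Qed.

Lemma tamari_cover_graftl t t' a s :
  tamari_cover t t' -> tamari_cover (graft t a s) (graft t' a s).
Proof.
move=> tt'; elim: tt' a => [x y z|l l' r ll' IH|l r r' rr' IH] a /=.
- case: (ltnP a (leaves z)) => [az|za].
    rewrite (leq_trans az) ?leq_addl //=; exact: tamari_rot.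
  rewrite ltn_subLR // [leaves z + _]addnC.
  case: ifP => _; first exact: tamari_rot.
  by rewrite addnC subnDA; exact: tamari_rot.
- by case: ifP => _; [exact: tamari_left | apply: tamari_left; exact: IH].
- rewrite !leavesE (tamari_cover_nodes rr').
  by case: ifP => _; [apply: tamari_right; exact: IH | exact: tamari_right].
Qed.

Lemma tamari_lt_graftl t t' a s :
  tamari_lt t t' -> tamari_lt (graft t a s) (graft t' a s).
Proof.
elim=> [x y xy|x y z _ xy _ yz]; first exact/t_step/tamari_cover_graftl.
exact: t_trans xy yz.
Qed.

Lemma tamari_max t :
  t = right_comb (nodes t) \/ tamari_lt t (right_comb (nodes t)).
Proof.
have [n] := ubnP (nodes t); elim: n t => // n IHn.
move=> [|l r] /=; first by left.
elim: l r => [|x IHx y _] r /=.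
  rewrite add0n => /IHn [<-|ltr]; [by left|right; exact: tamari_lt_right].
move=> szn; right.
have rot : tamari_lt (Node (Node x y) r) (Node x (Node y r)).
  exact/t_step/tamari_rot.
have eqn : nodes x + (nodes y + nodes r).+1 = (nodes x + nodes y).+1 + nodes r.
  by rewrite addnS addSn addnA.
have := IHx (Node y r); rewrite /= eqn => /(_ szn) [eqx|ltx].
  by rewrite -eqx.
exact: t_trans rot ltx.
Qed.

Lemma graft_neq_comb t a s m :
  0 < a < leaves t -> 0 < nodes s -> graft t a s <> right_comb m.
Proof.
elim: t a m => [|l IHl r IHr] a m /=.
  by case: a.
case/andP=> a0 al s0; case: ifP => ar.
  by case: m => //= m [_]; apply: IHr; rewrite ?a0.
case: m => //= m [eqL _].
by move: (congr1 nodes eqL); rewrite nodes_graft /= => /eqP;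
  rewrite addn_eq0 [nodes s == 0]eqn0Ngt s0 andbF.
Qed.

Lemma graft_lt_comb t a s :
  0 < a < leaves t -> 0 < nodes s ->
  tamari_lt (graft t a s) (right_comb (nodes t + nodes s)).
Proof.
move=> at_ s0; rewrite -(nodes_graft t a s).
by case: (tamari_max (graft t a s)) => // /(graft_neq_comb at_ s0).
Qed.

Lemma tamari_chain_cone n s :
  size s = n.+1 ->
  (forall i, i < n.+1 -> Y n.+2 (nth Leaf s i)) ->
  (forall i, i < n -> tamari_lt (nth Leaf s i) (nth Leaf s i.+1)) ->
  tamari_lt (nth Leaf s n) (south_pole n.+1) ->
  tamari_chain n.+1 (cone n.+1 s).
Proof.
move=> szs Ys lts ltS; split.
- by rewrite size_rcons szs.
- move=> i; rewrite ltnS leq_eqVlt nth_rcons szs => /orP[/eqP ->|lti].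
    by rewrite ltnn eqxx /Y /= nodes_right_comb.
  by rewrite lti; exact: Ys.
- move=> i; rewrite ltnS leq_eqVlt !nth_rcons szs => /orP[/eqP ->|lti].
    by rewrite ltnSn ltnn eqxx.
  by rewrite ltnS (ltnW lti) ltnS lti; exact: lts.
Qed.

Lemma shuffle_count p q theta :
  shuffle p q theta ->
  [/\ size theta = p + q, count (fun x => x <= p) theta = p &
      count (fun x => p < x) theta = q].
Proof.
case=> eqth _ _; have szth : size theta = p + q.
  by rewrite (perm_size eqth) size_iota.
have cp : count (fun x => x <= p) theta = p.
  rewrite (permP eqth) iotaD count_cat.
  have /eqP -> : count (fun x => x <= p) (iota 1 p) == p.
    rewrite -{3}(size_iota 1 p) -all_count; apply/allP => x.
    by rewrite mem_iota add1n ltnS => /andP[].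
  have /eqP -> : count (fun x => x <= p) (iota (1 + p) q) == 0.
    rewrite -leqn0 leqNgt -has_count -all_predC; apply/allP => x.
    by rewrite mem_iota /= add1n -ltnNge => /andP[].
  by rewrite addn0.
split=> //; apply/eqP; rewrite -(eqn_add2l p) -szth -{1}cp.
rewrite -(count_predC (fun x => x <= p) theta) eqn_add2l; apply/eqP.
by apply: eq_count => x /=; rewrite ltnNge.
Qed.

Lemma count_take_le (P : pred nat) k theta :
  count P (take k theta) <= count P theta.
Proof. by rewrite -{2}(cat_take_drop k theta) count_cat leq_addr. Qed.

Lemma triangulation_tamari_chain n : triangulation n `<=` tamari_chain n.
Proof.
move=> s; elim=> {n s} [|n om _ [szo Yo lto]
  |a p q al be th p0 /andP[a0 ap] _ [sza Ya lta] _ [szb Yb ltb] shf].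
- by split=> // -[].
- apply: tamari_chain_cone.
  + by rewrite size_map.
  + move=> i lti; rewrite (nth_map Leaf) ?szo // /Y /= addn0.
    by rewrite (Yo _ lti).
  + move=> i lti; rewrite !(nth_map Leaf) ?szo ?ltnS // 1?ltnW //.
    exact/tamari_lt_graftr/lto.
  + rewrite (nth_map Leaf) ?szo //.
    have Yn := Yo _ (ltnSn n).
    by have := @graft_lt_comb cherry 1 (nth Leaf om n) isT;
      rewrite Yn => /(_ isT).
- have [szt cp cq] := shuffle_count shf.
  have ci k : count (fun x => x <= p) (take k th) < p.+1.
    by rewrite ltnS -{2}cp count_take_le.
  have cj k : count (fun x => p < x) (take k th) < q.+1.
    by rewrite ltnS -{1}cq count_take_le.
  have nthP k : k < (p + q).+1 -> nth Leaf (product_simplex a p al be th) k =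
      graft (nth Leaf al (count (fun x => x <= p) (take k th))) a
            (nth Leaf be (count (fun x => p < x) (take k th))).
    move=> ltk; rewrite (nth_map 0) ?size_iota ?szt //.
    by rewrite nth_iota.
  apply: tamari_chain_cone.
  + by rewrite size_map size_iota szt.
  + move=> k ltk; rewrite nthP // /Y /= nodes_graft.
    by rewrite (Ya _ (ci k)) (Yb _ (cj k)) addSn addnS.
  + move=> k ltk; rewrite !nthP ?ltnS // 1?ltnW //.
    have := ci k.+1; have := cj k.+1.
    rewrite (take_nth 0) ?szt // -cats1 !count_cat /= !addn0.
    case: (leqP (nth 0 th k) p) => _; rewrite !(addn0, addn1) => ltj lti.
      exact/tamari_lt_graftl/lta.
    exact/tamari_lt_graftr/ltb.
  + rewrite nthP // -szt take_size cp cq szt.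
    have Yp := Ya p (ltnSn p); have Yq := Yb q (ltnSn q).
    have := @graft_lt_comb (nth Leaf al p) a (nth Leaf be q).
    rewrite leavesE Yp Yq a0 ltnS ap addSn addnS => /(_ isT isT).
    exact.
Qed.

(* Main.v *)
Require Import Defs.
From HB Require Import structures.
From mathcomp Require Import all_boot zify.
From mathcomp Require Import classical_sets functions.

(** The two sides have the same recursive structure, so both are compared with
    one relation [encodes n s u], generated by the rules

      - [[:: cherry]] is encoded by the empty sequence;
      - if [alpha] is encoded by [u] and [beta] by [v], with p + q = n, then
        the cone over the lattice path [b] in [alpha x beta], placed in the
        facet [gamma(a;p,q)] with [1 <= a <= p + 1], is encoded by
        [(a, interleaving of u and p + 1 + v according to b)].

    A shuffle is the same thing as the sequence [b] of booleans telling which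
    of its letters are at most p, and case (1) of the triangulation is the
    instance p = 0, a = 1 of the second rule. Hence a simplex is a sequence of
    trees that has an encoding, and every function satisfying the recursion
    sends a simplex to its encoding. The theorem says that [encodes n] is the
    graph of a bijection onto the parking functions; this is an induction on n
    whose step is a unique decomposition on each side.

    Parking functions. A sequence of positive integers is a parking function
    of length n when it has n entries and, for every k <= n, at least k of them
    are at most k. Let [a :: w] be one. If p + 1 is the least k such that [w]
    has fewer than k entries at most k, then [w] has exactly p entries at most
    p and none equal to p + 1; the entries at most p form a parking function of
    length p, the others minus p + 1 form one of length q, and the condition
    on [a :: w] at p + 1 says a <= p + 1. Conversely any such data give a
    parking function in which p is recovered in this way
    ([parking_split], [parking_assemble], [assemble_inj]).

    Simplices. What must be recovered from the vertices is the facet in which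
    the base of the cone lies. A facet of the associahedron corresponds to an
    interval of leaves, and a tree lies on it when the interval is the set of
    leaves of a subtree, a bracket of the tree. The vertices of an n-simplex
    span the associahedron, so they lie on no common facet: by induction, the
    only bracket that they share is the set of all leaves. Indeed a bracket
    shared by all [graft v a w] along a path comes either from a bracket
    shared by all [v] or from one shared by all [w], since a path visits
    every [v] and every [w]; so the path shares only the full bracket and the
    grafted one, and the latter is not a bracket of the South pole because
    a >= 1 ([product_common_bracket], [generic_cone]). The shared bracket of
    the base therefore gives a, p and q; then grafting is injective, and a
    lattice path in a product of two sequences without repetitions determines
    the path and the two sequences ([product_inj]). *)

Set Implicit Arguments.
Unset Strict Implicit.
Unset Printing Implicit Defensive.

(** * Interleavings and shuffles *)

(** Here and below, [true] in [b] takes the next entry of [u] and [false] that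
    of [v]; the two counts of [b] are meant to be the two lengths. *)
Fixpoint interleave (T : Type) (b : bitseq) (u v : seq T) : seq T :=
  match b, u, v with
  | true :: b', x :: u', _ => x :: interleave b' u' v
  | false :: b', _, y :: v' => y :: interleave b' u v'
  | _, _, _ => [::]
  end.

Lemma map_interleave (T U : Type) (f : T -> U) b u v :
  [seq f x | x <- interleave b u v]
  = interleave b [seq f x | x <- u] [seq f x | x <- v].
Proof. by elim: b u v => [|[] b IH] [|x u] [|y v] //=; rewrite IH. Qed.

Lemma count_interleave (T : Type) (P : pred T) b u v :
  count id b = size u -> count negb b = size v ->
  count P (interleave b u v) = count P u + count P v.
Proof.
elim: b u v => [|[] b IH] [|x u] [|y v] //=; rewrite ?add1n ?add0n //.
- by move=> [bu] bv; rewrite IH ?addn0.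
- by move=> [bu] bv; rewrite IH //= addnA.
- by move=> bu [bv]; rewrite IH.
- by move=> bu [bv]; rewrite IH //= addnCA.
Qed.

Lemma interleave_filter (T : Type) (P : pred T) w :
  interleave (map P w) (filter P w) (filter (predC P) w) = w.
Proof. by elim: w => //= x w IH; case: (P x) => /=; rewrite IH. Qed.

(** When a predicate separates the entries of [u] from those of [v], an
    interleaving can be undone. *)
Lemma interleave_inj (T : Type) (P : pred T) b u v :
  count id b = size u -> count negb b = size v ->
  all P u -> all (predC P) v ->
  [/\ map P (interleave b u v) = b, filter P (interleave b u v) = u
    & filter (predC P) (interleave b u v) = v].
Proof.
elim: b u v => [|[] b IH] [|x u] [|y v] //=; rewrite ?add1n ?add0n //.
- move=> [bu] bv /andP[-> Pu] _ /=.
  by have [-> -> ->] := IH _ [::] bu bv Pu isT.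
- move=> [bu] bv /andP[-> Pu] /andP[ny Pv] /=.
  by have [-> -> ->] := IH _ (y :: v) bu bv Pu (introT andP (conj ny Pv)).
- move=> bu [bv] _ /andP[/negbTE -> Pv] /=.
  by have [-> -> ->] := IH [::] _ bu bv isT Pv.
- move=> bu [bv] /andP[Px Pu] /andP[/negbTE -> Pv] /=.
  by have [-> -> ->] := IH (x :: u) _ bu bv (introT andP (conj Px Pu)) Pv.
Qed.

Lemma interleave_nill (T : Type) b (v : seq T) :
  count id b = 0 -> count negb b = size v -> interleave b [::] v = v.
Proof. by elim: b v => [|[] b IH] [|y v] //= b0 [bv]; rewrite IH. Qed.

Lemma count_id_negb b : count id b + count negb b = size b.
Proof. by rewrite -(count_predC id b). Qed.

Definition shuffle_of p q b := interleave b (iota 1 p) (iota p.+1 q).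

Lemma shuffle_ofP p q b : count id b = p -> count negb b = q ->
  shuffle p q (shuffle_of p q b) /\ [seq x <= p | x <- shuffle_of p q b] = b.
Proof.
move=> bp bq.
have [||||mapb fu fv] := @interleave_inj _ (leq^~ p) b (iota 1 p) (iota p.+1 q).
- by rewrite size_iota.
- by rewrite size_iota.
- by apply/allP => x; rewrite mem_iota; lia.
- by apply/allP => x; rewrite mem_iota /=; lia.
split=> //; split.
- apply/permP => P.
  by rewrite count_interleave ?size_iota // iotaD count_cat add1n.
- by rewrite fu; apply: iota_ltn_sorted.
- rewrite (@eq_filter _ _ (predC (leq^~ p))); last by move=> x /=; lia.
  by rewrite fv; apply: iota_ltn_sorted.
Qed.

(** The letters of either kind occur in increasing order, so the only freedom
    in a shuffle is the kind of each letter. *)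
Lemma shuffleE p q theta : shuffle p q theta ->
  let b := [seq x <= p | x <- theta] in
  [/\ count id b = p, count negb b = q & theta = shuffle_of p q b].
Proof.
move=> sh b; have [_ cp cq] := shuffle_count sh; case: sh => eqth slo shi.
have ltn_irr : irreflexive ltn by move=> x; apply: ltnn.
have lo : [seq x <- theta | x <= p] = iota 1 p.
  apply: (irr_sorted_eq ltn_trans ltn_irr slo (iota_ltn_sorted _ _)) => x.
  by rewrite mem_filter (perm_mem eqth) !mem_iota; lia.
have hi : [seq x <- theta | p < x] = iota p.+1 q.
  apply: (irr_sorted_eq ltn_trans ltn_irr shi (iota_ltn_sorted _ _)) => x.
  by rewrite mem_filter (perm_mem eqth) !mem_iota; lia.
split.
- by rewrite count_map.
- by rewrite count_map -[RHS]cq; apply: eq_count => x /=; lia.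
rewrite -[LHS](interleave_filter (leq^~ p)) /shuffle_of lo.
by rewrite -hi; congr interleave; apply: eq_filter => x /=; lia.
Qed.

(** The action on words commutes with interleaving, and sends the identity word
    [iota 1 p ++ iota p.+1 q] to [u ++ v]. *)
Lemma shuffle_act_interleave p q b u v :
  size u = p -> size v = q ->
  shuffle_act (shuffle_of p q b) (u ++ v) = interleave b u v.
Proof.
move=> su sv; rewrite /shuffle_act map_interleave; congr interleave.
- apply: (@eq_from_nth _ 0); first by rewrite size_map size_iota.
  move=> i; rewrite size_map size_iota => ip.
  by rewrite (nth_map 0) ?size_iota // nth_iota // nth_cat add1n /= su ip.
- apply: (@eq_from_nth _ 0); first by rewrite size_map size_iota.
  move=> i; rewrite size_map size_iota => iq.
  rewrite (nth_map 0) ?size_iota // nth_iota // nth_cat addSn /= su.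
  by rewrite ltnNge leq_addr /= addKn.
Qed.

(** * Parking functions *)

Lemma sorted_nth_leq s i k : sorted leq s -> i < size s ->
  (nth 0 s i <= k) = (i < count (leq^~ k) s).
Proof.
elim: s i => [|x s IH] i //= sx.
have ge_x : all (leq x) s by apply: order_path_min sx; apply: leq_trans.
have [lexk|ltkx] := leqP x k.
  by case: i => [|i] //= ?; rewrite ltnS IH // (path_sorted sx).
have /eqP -> : count (leq^~ k) s == 0.
  rewrite -leqn0 leqNgt -has_count; apply/hasPn => y /(allP ge_x) /=; lia.
case: i => [|i] /= ilt; first by lia.
have /= xi := allP ge_x _ (mem_nth 0 ilt).
by rewrite addn0 ltn0 leqNgt (leq_trans ltkx xi).
Qed.

(** Counting entries is insensitive to order, so this form, unlike the sorted
    one, is compatible with interleaving and with splitting. *)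
Lemma parking_countP n u :
  parking n u <->
  [/\ size u = n, all (leq 1) u & forall k, k <= n -> k <= count (leq^~ k) u].
Proof.
have pu : perm_eq (sort leq u) u by rewrite perm_sort.
have ss : sorted leq (sort leq u) by apply: sort_sorted; apply: leq_total.
split.
- case=> su H; split=> //.
    rewrite -(perm_all _ pu); apply/(all_nthP 0) => i.
    by rewrite size_sort su => /H /andP[].
  case=> // k kn; rewrite -(permP pu) -sorted_nth_leq ?size_sort ?su //.
  by case/andP: (H _ kn).
- case=> su u1 H; split=> // k kn; apply/andP; split.
    have : all (leq 1) (sort leq u) by rewrite (perm_all _ pu).
    by move/(all_nthP 0); apply; rewrite size_sort su.
  by rewrite sorted_nth_leq ?size_sort ?su // (permP pu); apply: H.
Qed.

Lemma parking_size n u : parking n u -> size u = n.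
Proof. by case. Qed.

Lemma parking_le n u : parking n u -> all (leq^~ n) u.
Proof.
move/parking_countP => [su _ /(_ n (leqnn n))] H.
by rewrite all_count eqn_leq count_size su.
Qed.

Section Assemble.
Variables (p q : nat) (b : bitseq) (u v : seq nat).
Hypotheses (pu : parking p u) (pv : parking q v).
Hypotheses (bp : count id b = p) (bq : count negb b = q).
Let w := interleave b u [seq p.+1 + x | x <- v].

Lemma count_assemble P :
  count P w = count P u + count (fun x => P (p.+1 + x)) v.
Proof.
rewrite count_interleave ?size_map ?(parking_size pu) ?(parking_size pv) //.
by rewrite count_map.
Qed.

Lemma count_assemble_low k : k <= p -> k <= count (leq^~ k) w.
Proof.
move=> kp; rewrite count_assemble.
by case/parking_countP: pu => _ _ /(_ k kp) /leq_trans; apply; apply: leq_addr.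
Qed.

Lemma count_assemble_high k :
  count (leq^~ (p.+1 + k)) w = p + count (leq^~ k) v.
Proof.
rewrite count_assemble; congr (_ + _).
  rewrite -[RHS](parking_size pu); apply/eqP; rewrite -all_count.
  by apply: sub_all (parking_le pu) => x /=; lia.
by apply: eq_count => x /=; lia.
Qed.

(** With [count_assemble_low], this characterizes p + 1 as the least k such that
    [w] has fewer than k entries at most k. *)
Lemma count_assemble_gap : count (leq^~ p.+1) w = p.
Proof.
rewrite -[X in leq^~ X]addn0 count_assemble_high.
have /eqP -> : count (leq^~ 0) v == 0; last by rewrite addn0.
rewrite -leqn0 leqNgt -has_count -all_predC.
by case/parking_countP: pv => _ v1 _; apply: sub_all v1 => x /=; lia.
Qed.

Lemma parking_assemble a : 0 < a <= p.+1 -> parking (p + q).+1 (a :: w).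
Proof.
case/andP=> a0 ap; apply/parking_countP; split.
- rewrite /= -(count_predT w) count_assemble !count_predT.
  by rewrite (parking_size pu) (parking_size pv).
- rewrite /= a0 all_count -(count_predT w) !count_assemble !count_predT /=.
  case/parking_countP: pu => _; rewrite all_count => /eqP -> _.
  by rewrite -(count_predT v).
- move=> k kn /=; have [kp|pk] := leqP k p.
    by apply: leq_trans (count_assemble_low kp) _; apply: leq_addl.
  rewrite -(subnKC pk) count_assemble_high.
  have kq : k - p.+1 <= q by lia.
  by case/parking_countP: pv => _ _ /(_ _ kq); lia.
Qed.

Lemma split_assemble :
  [/\ [seq x <= p | x <- w] = b, [seq x <- w | x <= p] = u &
      filter (predC (leq^~ p)) w = [seq p.+1 + x | x <- v]].
Proof.
apply: (@interleave_inj _ (leq^~ p)).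
- by rewrite bp (parking_size pu).
- by rewrite bq size_map (parking_size pv).
- exact: parking_le pu.
- by rewrite all_map; apply/allP => x _ /=; lia.
Qed.
End Assemble.

(** Each p is the position of the first gap of the common word; p then tells the
    entries of [u] from those of the shifted [v]. *)
Lemma assemble_inj p q b u v p' q' b' u' v' :
  parking p u -> parking q v -> count id b = p -> count negb b = q ->
  parking p' u' -> parking q' v' -> count id b' = p' -> count negb b' = q' ->
  interleave b u [seq p.+1 + x | x <- v]
    = interleave b' u' [seq p'.+1 + x | x <- v'] ->
  [/\ p = p', b = b', u = u' & v = v'].
Proof.
move=> pu pv bp bq pu' pv' bp' bq' E.
have gap := count_assemble_gap pu pv bp bq.
have gap' := count_assemble_gap pu' pv' bp' bq'.
have low := @count_assemble_low _ _ _ _ _ pu pv bp bq.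
have low' := @count_assemble_low _ _ _ _ _ pu' pv' bp' bq'.
have [eb eu ev] := split_assemble pu pv bp bq.
have [eb' eu' ev'] := split_assemble pu' pv' bp' bq'.
have pp : p = p'.
  have [ltp|ltp|//] := ltngtP p p'.
  - by have := low' _ ltp; rewrite -E gap ltnn.
  - by have := low _ ltp; rewrite E gap' ltnn.
split=> //.
- by rewrite -eb -eb' E pp.
- by rewrite -eu -eu' E pp.
- apply: (inj_map (@addnI p.+1)).
  by rewrite -ev [in RHS]pp -ev' E pp.
Qed.

(** The cut is made at the first gap: minimality makes the entries at most p a
    parking function, and at most p of the at least p + k entries of [w] that are
    at most p + 1 + k lie in the first part, which leaves k for the second. *)
Lemma parking_split n a w : parking n.+1 (a :: w) ->
  exists p q b u v,
    [/\ p + q = n, 0 < a <= p.+1, parking p u & parking q v] /\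
    [/\ count id b = p, count negb b = q
      & w = interleave b u [seq p.+1 + x | x <- v]].
Proof.
case/parking_countP=> /= -[sw] /andP[a0 w1] H.
have exk : exists k, count (leq^~ k) w < k.
  by exists n.+1; rewrite ltnS -sw count_size.
case: (ex_minnP exk) => -[//|p]; rewrite ltnS => gap minp.
have pn : p <= n by rewrite -ltnS; apply: minp; rewrite ltnS -sw count_size.
have low k : k <= p -> k <= count (leq^~ k) w.
  move=> kp; rewrite leqNgt; apply/negP => /minp; lia.
have mono : count (leq^~ p) w <= count (leq^~ p.+1) w.
  by apply: sub_count => x /=; lia.
have cp : count (leq^~ p) w = p by have := low p (leqnn p); lia.
have Cp : count (leq^~ p.+1) w = p by lia.
pose v0 := filter (predC (leq^~ p)) w.
have ge_v0 : all (leq p.+2) v0.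
  (* The counts at p and at p + 1 agree, so p + 1 does not occur in w. *)
  have H0 : count (pred1 p.+1) w = 0.
    have := count_predUI (pred1 p.+1) (leq^~ p) w.
    rewrite (@eq_count _ _ (leq^~ p.+1)) => [|x /=]; last by lia.
    rewrite (@eq_count _ (predI _ _) pred0) => [|x /=]; last by lia.
    by rewrite count_pred0 Cp cp; lia.
  apply/allP => x; rewrite mem_filter /= => /andP[px xw].
  have : x != p.+1; last by lia.
  apply: contraTneq xw => ->; apply/count_memPn; exact: H0.
have split_count (k : nat) :
    count (leq^~ (p.+1 + k)) w = p + count (leq^~ (p.+1 + k)) v0.
  have /permP/(_ (leq^~ (p.+1 + k))) := permEl (perm_filterC (leq^~ p) w).
  rewrite count_cat -/v0 => <-; congr (_ + _).
  rewrite -[RHS]cp -[RHS]size_filter; apply/eqP; rewrite -all_count.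
  by apply/allP => x; rewrite mem_filter /=; lia.
have sv0 : size v0 = n - p.
  by rewrite /v0 size_filter -sw -(count_predC (leq^~ p) w) cp addKn.
exists p, (n - p), [seq x <= p | x <- w], [seq x <- w | x <= p].
exists [seq x - p.+1 | x <- v0]; split; split.
- by rewrite subnKC.
- rewrite a0 /=; case: (leqP a p.+1) => // pa.
  by have := H p.+1 pn; rewrite Cp [a <= _]leqNgt pa /= ltnn.
- apply/parking_countP; split; first by rewrite size_filter.
    by apply/allP => x; rewrite mem_filter => /andP[_ /(allP w1)].
  move=> k kp; apply: leq_trans (low k kp) _.
  by rewrite count_filter; apply: sub_count => x /=; lia.
- apply/parking_countP; split; first by rewrite size_map.
    by rewrite all_map; apply: sub_all ge_v0 => x /=; lia.
  move=> k kn; rewrite count_map.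
  rewrite (@eq_count _ _ (leq^~ (p.+1 + k))) => [|x /=]; last by lia.
  have := split_count k; have := H (p.+1 + k); have := leq_b1 (a <= p.+1 + k).
  by lia.
- by rewrite count_map.
- by rewrite count_map -[RHS]sv0 size_filter.
rewrite -{1}(interleave_filter (leq^~ p) w); congr interleave.
rewrite -map_comp -[LHS]map_id; apply/eq_in_map => x /(allP ge_v0) /=.
by lia.
Qed.

(** * Trees and their brackets *)

Lemma tree_eq_dec : comparable tree.
Proof. by rewrite /comparable /decidable; decide equality. Qed.
HB.instance Definition _ := hasDecEq.Build tree (compareP tree_eq_dec).

Lemma leaves_gt0 t : 0 < leaves t.
Proof. by rewrite leavesE. Qed.

Lemma leaves_graft t a s : (leaves (graft t a s)).+1 = leaves t + leaves s.
Proof. by rewrite !leavesE nodes_graft addSn addnS. Qed.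

(** The position of the graft is the same on both sides once the numbers of
    leaves agree, so both recursions follow the same branch. *)
Lemma graft_inj t s t' s' a :
  leaves t = leaves t' -> leaves s = leaves s' -> a < leaves t ->
  graft t a s = graft t' a s' -> t = t' /\ s = s'.
Proof.
move=> + ss; elim: t t' a => [|l IHl r IHr] [|l' r'] a /=.
- by [].
- by have := leaves_gt0 l'; have := leaves_gt0 r'; lia.
- by have := leaves_gt0 l; have := leaves_gt0 r; lia.
move=> tt at_; have lr := leaves_graft r a s; have lr' := leaves_graft r' a s'.
have s0 := leaves_gt0 s.
case: ltnP => ar; case: ltnP => ar' [El Er].
- subst l'; have rr : leaves r = leaves r' by move: tt; lia.
  by have [-> ->] := IHr r' a rr ar Er.
- by rewrite -Er in ar'; lia.
- by rewrite Er in ar; lia.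
- subst r'; have ll : leaves l = leaves l' by move: tt; lia.
  have al : a - leaves r < leaves l by lia.
  by have [-> ->] := IHl l' _ ll al El.
Qed.

(** [bracket d t x y]: when the leaves of [t] are numbered from right to left
    starting at [d], some subtree of [t] that is not a leaf has exactly the
    leaves [x], ..., [y - 1]. The offset [d] makes subtrees keep the numbering of
    the whole tree. *)
Fixpoint bracket d t x y : bool :=
  if t is Node l r then
    [|| (x == d) && (y == d + leaves t), bracket d r x y
      | bracket (d + leaves r) l x y]
  else false.

Lemma bracket_bounds d t x y : bracket d t x y ->
  [/\ d <= x, x.+1 < y & y <= d + leaves t].
Proof.
elim: t d => [|l IHl r IHr] d //=.
have := leaves_gt0 l; have := leaves_gt0 r => r0 l0.
by case/or3P => [/andP[/eqP -> /eqP ->]|/IHr[]|/IHl[]]; split; lia.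
Qed.

Lemma bracket_shift e d t x y :
  bracket (d + e) t x y -> bracket d t (x - e) (y - e).
Proof.
elim: t d => [|l IHl r IHr] d //=.
case/or3P => [/andP[/eqP -> /eqP ->]|/IHr ->|].
- by rewrite !addnK addnAC addnK !eqxx.
- by rewrite orbT.
- by rewrite addnAC => /IHl ->; rewrite !orbT.
Qed.

Lemma bracket_root d t : t <> Leaf -> bracket d t d (d + leaves t).
Proof. by case: t => //= l r _; rewrite !eqxx. Qed.

Lemma bracket_graft_root d t a s : a < leaves t -> s <> Leaf ->
  bracket d (graft t a s) (d + a) (d + a + leaves s).
Proof.
move=> + sN; elim: t d a => [|l IHl r IHr] d a /=.
  by case: a => // _; rewrite addn0 bracket_root.
move=> at_; case: ifP => ar /=; first by rewrite IHr ?orbT.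
have -> : d + a = d + leaves r + (a - leaves r) by lia.
by rewrite IHl ?orbT //; lia.
Qed.

(** The brackets of [graft t a s] are those of [s], shifted by [a], and those of
    [t], with leaf [a] expanded into the leaves of [s]. A bracket of [t] has at
    least two leaves, so once expanded it never lies inside the leaves of [s]:
    the positions of [x] and [y] alone tell the two kinds apart. *)
Lemma bracket_graft_in d t a s x y : a < leaves t ->
  d + a <= x -> y <= d + a + leaves s ->
  bracket d (graft t a s) x y -> bracket (d + a) s x y.
Proof.
elim: t d a => [|l IHl r IHr] d a /=.
  by case: a => // _; rewrite addn0.
have s0 := leaves_gt0 s; have := leaves_gt0 l; have := leaves_gt0 r => r0 l0.
move=> at_ dx yd; case: ifP => ar /=.
  have := leaves_graft r a s => lg.
  case/or3P => [/andP[/eqP ? /eqP ?]|/IHr->//|/bracket_bounds[]]; lia.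
have := leaves_graft l (a - leaves r) s => lg.
case/or3P => [/andP[/eqP ? /eqP ?]|/bracket_bounds[]|/IHl]; try lia.
by rewrite -addnA subnKC; [apply; lia|lia].
Qed.

(** The brackets of a tree are pairwise nested or disjoint: the left end of one
    that leaves the grafted interval on the upper side is not inside it. *)
Lemma bracket_graft_compat d t a s x y : a < leaves t ->
  bracket d (graft t a s) x y ->
  [|| x <= d + a, d + a + leaves s <= x | y <= d + a + leaves s].
Proof.
elim: t d a => [|l IHl r IHr] d a /=.
  by case: a => // _ /bracket_bounds[_ _ yd]; rewrite addn0 yd !orbT.
move=> at_; case: ifP => ar /=.
  have lg := leaves_graft r a s.
  case/or3P => [/andP[/eqP -> _]|/(IHr _ _ ar)//|/bracket_bounds[xl _ _]].
  - by rewrite leq_addr.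
  - by apply/or3P/Or32; lia.
have e : d + leaves r + (a - leaves r) = d + a by lia.
have al : a - leaves r < leaves l by lia.
case/or3P => [/andP[/eqP -> _]|/bracket_bounds[_ xy yr]|/(IHl _ _ al)].
- by rewrite leq_addr.
- by apply/or3P/Or31; lia.
- by rewrite e.
Qed.

(** The effect on the ends of an interval of collapsing the [m] leaves starting
    at [c] to the single leaf [c]. *)
Definition contract c m z := if z <= c then z else z - m.-1.

(** The brackets that do not lie inside the leaves of [s] come from [t]. *)
Lemma bracket_graft_out d t a s x y : a < leaves t ->
  ~~ ((d + a <= x) && (y <= d + a + leaves s)) ->
  bracket d (graft t a s) x y ->
  bracket d t (contract (d + a) (leaves s) x) (contract (d + a) (leaves s) y).
Proof.
elim: t d a => [|l IHl r IHr] d a /=.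
  by case: a => // _ + /bracket_bounds[dx _ yd]; rewrite addn0 dx yd.
have s0 := leaves_gt0 s; have := leaves_gt0 l; have := leaves_gt0 r => r0 l0.
move=> at_ out; case: ifP => ar /=.
  have lg := leaves_graft r a s.
  case/or3P => [/andP[/eqP -> /eqP ->]|/(IHr _ _ ar out) ->|bl].
  - apply/orP; left; rewrite /contract leq_addr eqxx /= {out}.
    by rewrite ifN; [apply/eqP; lia | rewrite -ltnNge; lia].
  - by rewrite orbT.
  - have [b1 b2 b3] := bracket_bounds bl; clear out IHl IHr.
    rewrite /contract !ifN -?ltnNge; [|lia..].
    apply/or3P/Or33/bracket_shift.
    by have -> : d + leaves r + (leaves s).-1 = d + leaves (graft r a s) by lia.
have lg := leaves_graft l (a - leaves r) s.
have e : d + leaves r + (a - leaves r) = d + a by lia.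
have al : a - leaves r < leaves l by lia.
case/or3P => [/andP[/eqP -> /eqP ->]|br|].
- apply/orP; left; rewrite /contract leq_addr eqxx /= {out}.
  by rewrite ifN; [apply/eqP; lia | rewrite -ltnNge; lia].
- have [b1 b2 b3] := bracket_bounds br; clear out IHl IHr.
  by rewrite /contract !ifT ?br ?orbT //; lia.
- move/(IHl _ _ al); rewrite e => /(_ out) ->.
  by rewrite !orbT.
Qed.

Lemma bracket_right_comb d m x y : bracket d (right_comb m) x y -> x = d.
Proof.
by elim: m => //= m IH /or3P[/andP[/eqP]|/IH|].
Qed.

(** * Lattice paths in a product of two sequences *)

Fixpoint walk (b : bitseq) (alpha beta : seq tree) : seq (tree * tree) :=
  (head Leaf alpha, head Leaf beta) ::
  match b with
  | [::] => [::]
  | true :: b' => walk b' (behead alpha) beta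
  | false :: b' => walk b' alpha (behead beta)
  end.

Lemma nth_walkE b alpha beta :
  [seq (nth Leaf alpha (count id (take k b)),
        nth Leaf beta (count negb (take k b))) | k <- iota 0 (size b).+1]
  = walk b alpha beta.
Proof.
elim: b alpha beta => [|c b IH] alpha beta; first by rewrite /= !nth0.
have -> : iota 0 (size (c :: b)).+1 = 0 :: map succn (iota 0 (size b).+1).
  by rewrite -(iotaDl 1).
rewrite map_cons -map_comp [walk _ _ _]/=; congr cons.
by case: c; rewrite -IH; apply: eq_map => k /=;
   rewrite ?add0n ?add1n nth_behead.
Qed.

Lemma mem_walk b alpha beta v w :
  count id b < size alpha -> count negb b < size beta ->
  (v, w) \in walk b alpha beta -> v \in alpha /\ w \in beta.
Proof.
elim: b alpha beta => [|c b IH] [|v0 alpha] [|w0 beta] //=.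
  by move=> _ _; rewrite inE => /eqP[-> ->]; rewrite !mem_head.
case: c; rewrite ?add1n ?add0n => ba bb;
  rewrite inE => /predU1P[[-> ->]|/IH]; rewrite ?mem_head //.
- by move=> /(_ ba bb)[va wb]; rewrite inE va orbT.
- by move=> /(_ ba bb)[va wb]; rewrite [w \in _]inE wb orbT.
Qed.

Lemma walk_onto_l b alpha beta v : size alpha = (count id b).+1 ->
  v \in alpha -> exists w, (v, w) \in walk b alpha beta.
Proof.
elim: b alpha beta => [|c b IH] [|v0 alpha] beta //=.
  case: alpha => // _; rewrite inE => /eqP ->.
  by exists (head Leaf beta); rewrite mem_head.
case: c; rewrite ?add1n ?add0n => -[sa].
- rewrite inE => /orP[/eqP ->|va].
    by exists (head Leaf beta); rewrite mem_head.
  by have [w vw] := IH alpha beta sa va; exists w; rewrite inE vw orbT.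
- move=> va; have [|w vw] := IH (v0 :: alpha) (behead beta) _ va.
    by rewrite /= sa.
  by exists w; rewrite inE vw orbT.
Qed.

Lemma walk_onto_r b alpha beta w : size beta = (count negb b).+1 ->
  w \in beta -> exists v, (v, w) \in walk b alpha beta.
Proof.
elim: b alpha beta => [|c b IH] alpha [|w0 beta] //=.
  case: beta => // _; rewrite inE => /eqP ->.
  by exists (head Leaf alpha); rewrite mem_head.
case: c; rewrite ?add1n ?add0n => -[sa].
- move=> va; have [|v vw] := IH (behead alpha) (w0 :: beta) _ va.
    by rewrite /= sa.
  by exists v; rewrite inE vw orbT.
- rewrite inE => /orP[/eqP ->|va].
    by exists (head Leaf alpha); rewrite mem_head.
  by have [v vw] := IH alpha beta sa va; exists v; rewrite inE vw orbT.
Qed.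

Lemma walk_uniq b alpha beta :
  size alpha = (count id b).+1 -> size beta = (count negb b).+1 ->
  uniq alpha -> uniq beta -> uniq (walk b alpha beta).
Proof.
elim: b alpha beta => [|c b IH] [|v alpha] [|w beta] //=.
case: c; rewrite ?add1n ?add0n => -[sa] [sb] /andP[va ua] /andP[wb ub].
- rewrite IH //= ?sb ?wb // andbT; apply: contra va.
  by case/mem_walk; rewrite ?sa //= sb.
- rewrite IH //= ?sa ?va // andbT; apply: contra wb.
  by case/mem_walk; rewrite ?sb //= sa.
Qed.

(** At every step exactly one coordinate changes, because neither sequence has
    repetitions; which one it is gives the next letter of [b]. *)
Lemma walk_inj b alpha beta b' alpha' beta' :
  size alpha = (count id b).+1 -> size beta = (count negb b).+1 ->
  size alpha' = (count id b').+1 -> size beta' = (count negb b').+1 ->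
  uniq alpha -> uniq alpha' ->
  walk b alpha beta = walk b' alpha' beta' ->
  [/\ b = b', alpha = alpha' & beta = beta'].
Proof.
have head_walk c al be :
    exists s, walk c al be = (head Leaf al, head Leaf be) :: s.
  by case: c => [|c0 c] /=; eexists.
elim: b b' alpha beta alpha' beta' => [|c b IH] [|c' b']
  [|v alpha] [|w beta] [|v' alpha'] [|w' beta'] //=.
- by case: alpha beta alpha' beta' => // -[] // [] // [] // _ _ _ _ _ _ [-> ->].
- by case: c'; [have [s ->] := head_walk b' alpha' (w' :: beta')
    | have [s ->] := head_walk b' (v' :: alpha') beta'].
- by case: c; [have [s ->] := head_walk b alpha (w :: beta)
    | have [s ->] := head_walk b (v :: alpha) beta].
case: c c' => -[]; rewrite ?add1n ?add0n => -[sa] [sb] [sa'] [sb']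
  /andP[va ua] /andP[va' ua'] [? ? E]; subst v' w'.
- have [||||||-> -> [->]] := IH _ _ _ _ _ _ _ _ _ _ _ E;
    rewrite /= ?sb ?sb'; done.
- move: E; have [s ->] := head_walk b alpha (w :: beta).
  have [s' ->] := head_walk b' (v :: alpha') beta' => -[E _ _] /=.
  by case: alpha va E sa {ua} => //= x al; rewrite inE => /negP H E;
     case: H; rewrite -E /= eqxx.
- move: E; have [s ->] := head_walk b (v :: alpha) beta.
  have [s' ->] := head_walk b' alpha' (w :: beta') => -[E _ _] /=.
  by case: alpha' va' E sa' {ua'} => //= x al; rewrite inE => /negP H E;
     case: H; rewrite E /= eqxx.
- have [||||||-> [->] ->] := IH _ _ _ _ _ _ _ _ _ _ _ E;
    rewrite /= ?sa ?sa' ?va ?va'; done.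
Qed.

Lemma walk_point b v beta :
  count id b = 0 -> size beta = (count negb b).+1 ->
  walk b [:: v] beta = [seq (v, w) | w <- beta].
Proof.
elim: b beta => [|[] b IH] [|w beta] //=; first by case: beta.
by move=> b0 [sb]; rewrite IH.
Qed.

(** * Simplices in a product facet *)

Definition product a b alpha beta : seq tree :=
  [seq graft vw.1 a vw.2 | vw <- walk b alpha beta].

Lemma product_simplexE a p alpha beta theta :
  product_simplex a p alpha beta theta
  = product a [seq x <= p | x <- theta] alpha beta.
Proof.
rewrite /product -nth_walkE -map_comp /product_simplex size_map.
apply: eq_map => k /=; rewrite -map_take !count_map.
congr (graft (nth _ _ _) _ (nth _ _ _)).
by apply: eq_count => x /=; rewrite ltnNge.
Qed.

(** The combinatorial substitute for the fact that the vertices of an n-simplex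
    are affinely independent: the last clause says that they lie on no common
    facet. *)
Definition generic n (s : seq tree) : Prop :=
  [/\ size s = n.+1, {in s, forall t, leaves t = n.+2}, uniq s
    & forall x y, {in s, forall t, bracket 0 t x y} -> x = 0 /\ y = n.+2].

(** With a point as first factor the cell is [gamma(1;0,q)], which is how case
    (1) of the triangulation becomes an instance of case (2). *)
Lemma product_point b beta :
  count id b = 0 -> size beta = (count negb b).+1 ->
  product 1 b [:: cherry] beta = [seq graft cherry 1 w | w <- beta].
Proof. by move=> b0 sb; rewrite /product walk_point // -map_comp. Qed.

Section Product.
Variables (a p q : nat) (b : bitseq) (alpha beta : seq tree).
Hypotheses (ap : 0 < a <= p.+1).
Hypotheses (galpha : generic p alpha) (gbeta : generic q beta).
Hypotheses (bp : count id b = p) (bq : count negb b = q).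

Lemma mem_product t : t \in product a b alpha beta ->
  exists v w, [/\ v \in alpha, w \in beta & t = graft v a w].
Proof.
case: galpha gbeta => sa _ _ _ [sb _ _ _].
case/mapP => -[v w] vw ->; exists v, w.
by have [|| ? ?] := mem_walk _ _ vw; rewrite ?sa ?sb ?bp ?bq.
Qed.

Lemma lt_leaves v : v \in alpha -> a < leaves v.
Proof. by case: galpha => _ lv _ _ /lv ->; case/andP: ap. Qed.

Lemma product_bracket t : t \in product a b alpha beta ->
  bracket 0 t a (a + q.+2).
Proof.
case/mem_product=> v [w] [va wb ->].
case: gbeta => _ /(_ w wb) lw _ _.
rewrite -lw; apply: (@bracket_graft_root 0); first exact: lt_leaves.
by case: w {wb} lw.
Qed.

(** Whether a bracket of [graft v a w] comes from [v] or from [w] depends only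
    on its position, so a bracket shared along the path is shared by all of
    [alpha] or by all of [beta], and is one of their full brackets. *)
Lemma product_common_bracket x y :
  {in product a b alpha beta, forall t, bracket 0 t x y} ->
  x = 0 /\ y = (p + q).+3 \/ x = a /\ y = a + q.+2.
Proof.
move=> H; have [sa lv _ Ha] := galpha; have [sb lw _ Hb] := gbeta.
have graftH v w : (v, w) \in walk b alpha beta -> bracket 0 (graft v a w) x y.
  by move=> vw; apply/H/mapP; exists (v, w).
have [/andP[ax ya]|out] := boolP ((a <= x) && (y <= a + q.+2)).
  right; have [w wb|] := Hb (x - a) (y - a); last by lia.
  have [|v vw] := walk_onto_r alpha (b := b) _ wb; first by rewrite sb bq.
  have [||va _] := mem_walk _ _ vw; rewrite ?sa ?sb ?bp ?bq //.
  apply: (@bracket_shift a 0); apply: bracket_graft_in (graftH _ _ vw) => //.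
    exact: lt_leaves.
  by rewrite (lw _ wb).
(* Collapsing is injective only outside the grafted interval. *)
have x_out : (x <= a) || (a + q.+2 <= x).
  have [v va] : exists v, v \in alpha.
    by case: (alpha) sa => // v al _; exists v; rewrite mem_head.
  have [|w vw] := walk_onto_l beta (b := b) _ va; first by rewrite sa bp.
  have [||_ wb] := mem_walk _ _ vw; rewrite ?sa ?sb ?bp ?bq //.
  have := @bracket_graft_compat 0 _ _ _ _ _ (lt_leaves va) (graftH _ _ vw).
  by rewrite !add0n (lw _ wb); case/or3P => [->|->|]; lia.
left; have [v va|] := Ha (contract a q.+2 x) (contract a q.+2 y); last first.
  case/andP: ap => a0 ap1; rewrite /contract.
  by case: (leqP x a) x_out; case: (leqP y a) => /= *; lia.
have [|w vw] := walk_onto_l beta (b := b) _ va; first by rewrite sa bp.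
have [||_ wb] := mem_walk _ _ vw; rewrite ?sa ?sb ?bp ?bq //.
rewrite -(lw _ wb); apply: (@bracket_graft_out 0) (graftH _ _ vw).
  exact: lt_leaves.
by rewrite (lw _ wb).
Qed.

(** The South pole has only brackets that start at leaf 0, which rules out the
    bracket of the facet. *)
Lemma generic_cone :
  generic (p + q).+1 (cone (p + q).+1 (product a b alpha beta)).
Proof.
have [sa lv ua _] := galpha; have [sb lw ub _] := gbeta.
split.
- rewrite size_rcons size_map -nth_walkE size_map size_iota.
  by rewrite -count_id_negb bp bq.
- move=> t; rewrite mem_rcons inE => /predU1P[->|].
    by rewrite leavesE nodes_right_comb.
  case/mem_product=> v [w] [va wb ->].
  by have := leaves_graft v a w; rewrite (lv _ va) (lw _ wb); lia.
- rewrite rcons_uniq map_inj_in_uniq ?walk_uniq ?sa ?sb ?bp ?bq // ?andbT.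
    apply/negP => /mem_product[v [w] [va wb]] /esym; apply: graft_neq_comb.
      by rewrite lt_leaves //; case/andP: ap => ->.
    by have := lw _ wb; rewrite leavesE; case: (nodes w).
  move=> [v w] [v' w'] vw vw' /= E.
  have [||va wb] := mem_walk _ _ vw; rewrite ?sa ?sb ?bp ?bq //.
  have [||va' wb'] := mem_walk _ _ vw'; rewrite ?sa ?sb ?bp ?bq //.
  have [|||-> ->] := graft_inj _ _ _ E;
    rewrite ?(lv v) ?(lv v') ?(lw w) ?(lw w') //.
  by case/andP: ap.
move=> x y H; have x0 : x = 0.
  apply: (@bracket_right_comb 0 (p + q).+2 x y).
  by apply: H; rewrite mem_rcons mem_head.
have [|[-> ->]|[xa _]] := @product_common_bracket x y => //.
  by move=> t tp; apply: H; rewrite mem_rcons inE tp orbT.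
by case/andP: ap; rewrite -xa x0.
Qed.
End Product.

(** The brackets shared by the base are the full one and the one of the facet,
    which starts at [a] and has q + 2 leaves, so the two facets agree. *)
Lemma product_inj a p q b alpha beta a' p' q' b' alpha' beta' :
  p + q = p' + q' ->
  0 < a <= p.+1 -> generic p alpha -> generic q beta ->
  count id b = p -> count negb b = q ->
  0 < a' <= p'.+1 -> generic p' alpha' -> generic q' beta' ->
  count id b' = p' -> count negb b' = q' ->
  product a b alpha beta = product a' b' alpha' beta' ->
  [/\ a = a', b = b', alpha = alpha' & beta = beta'].
Proof.
move=> pq ap ga gb bp bq ap' ga' gb' bp' bq' E.
have [aa qq] : a' = a /\ q' = q.
  have := @product_common_bracket a p q b _ _ ap ga gb bp bq a' (a' + q'.+2).
  rewrite E => -[t tp||]; first exact: (product_bracket ap' ga' gb' bp' bq').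
    by case=> a0; move: ap'; rewrite a0.
  by lia.
have pp : p' = p by lia.
move: ap' ga' gb' bp' bq' E; rewrite aa pp qq => _ ga' gb' bp' bq' E.
have [sa lv ua _] := ga; have [sb lw ub _] := gb.
have [sa' lv' ua' _] := ga'; have [sb' lw' ub' _] := gb'.
suff /walk_inj H : walk b alpha beta = walk b' alpha' beta'.
  by have [||||||-> -> ->] := H; rewrite ?bp ?bq ?bp' ?bq'.
have memw v w : (v, w) \in walk b alpha beta -> v \in alpha /\ w \in beta.
  by apply: mem_walk; rewrite ?sa ?sb ?bp ?bq.
have memw' v w : (v, w) \in walk b' alpha' beta' -> v \in alpha' /\ w \in beta'.
  by apply: mem_walk; rewrite ?sa' ?sb' ?bp' ?bq'.
rewrite /product in E.
elim: (walk b alpha beta) (walk b' alpha' beta') memw memw' E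
  => [|[v w] s IH] [|[v' w'] s'] //= Hs Hs' [E Es].
have [va wb] := Hs v w (mem_head _ _).
have [va' wb'] := Hs' v' w' (mem_head _ _).
have [||| -> ->] := graft_inj _ _ _ E.
- by rewrite lv // lv'.
- by rewrite lw // lw'.
- by rewrite lv //; case/andP: ap.
congr cons; apply: IH Es => v1 w1 i1; [apply: Hs | apply: Hs'];
  by rewrite inE i1 orbT.
Qed.

(** * Encoding simplices by parking functions *)

Inductive encodes : nat -> seq tree -> seq nat -> Prop :=
| encodes_point : encodes 0 [:: cherry] [::]
| encodes_cone n a p q b alpha beta u v :
    p + q = n -> 0 < a <= p.+1 -> encodes p alpha u -> encodes q beta v ->
    count id b = p -> count negb b = q ->
    encodes n.+1 (cone n.+1 (product a b alpha beta))
            (a :: interleave b u [seq p.+1 + x | x <- v]).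

Lemma encodes_generic n s u : encodes n s u -> generic n s.
Proof.
elim=> {n s u} [|n a p q b alpha beta u v <- ap _ ga _ gb bp bq].
  split=> // [t|x y /(_ cherry (mem_head _ _))].
    by rewrite inE => /eqP ->.
  by rewrite /= !orbF => /andP[/eqP -> /eqP ->].
exact: generic_cone.
Qed.

Lemma encodes_parking n s u : encodes n s u -> parking n u.
Proof.
elim=> {n s u} [|n a p q b alpha beta u v <- ap _ pu _ pv bp bq].
  by split.
exact: parking_assemble.
Qed.

Lemma encodes_fun n s u u' : encodes n s u -> encodes n s u' -> u = u'.
Proof.
move=> E; elim: E u' => {n s u} [|
  n a p q b alpha beta u v pq ap Ea IHa Eb IHb bp bq] u' E'.
  by inversion E'.
inversion E' as
  [|n' a' p' q' b' alpha' beta' u1 v1 pq' ap' Ea' Eb' bp' bq' E1 Es E3].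
have {}Es : product a b alpha beta = product a' b' alpha' beta'.
  by case: (rcons_inj (esym Es)).
have [aa bb ea eb] := product_inj (etrans pq (esym pq')) ap
  (encodes_generic Ea) (encodes_generic Eb) bp bq
  ap' (encodes_generic Ea') (encodes_generic Eb') bp' bq' Es.
have pp : p' = p by rewrite -bp -bp' bb.
have qq : q' = q by rewrite -bq -bq' bb.
by subst; rewrite (IHa u1) // (IHb v1).
Qed.

Lemma encodes_inj n s s' u : encodes n s u -> encodes n s' u -> s = s'.
Proof.
move=> E; elim: E s' => {n s u} [|
  n a p q b alpha beta u v pq ap Ea IHa Eb IHb bp bq] s' E'.
  by inversion E'.
inversion E' as
  [|n' a' p' q' b' alpha' beta' u1 v1 pq' ap' Ea' Eb' bp' bq' E1 E2 [E3 E4]].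
have [pp bb uu vv] := assemble_inj
   (encodes_parking Ea) (encodes_parking Eb) bp bq
   (encodes_parking Ea') (encodes_parking Eb') bp' bq' (esym E4).
have qq : q' = q by rewrite -bq -bq' bb.
by subst; rewrite (IHa alpha') // (IHb beta').
Qed.

Lemma parking_encodes n u : parking n u -> exists s, encodes n s u.
Proof.
elim/ltn_ind: n u => -[|n] IH [|a w] pu; try by case: pu.
  by exists [:: cherry]; exact: encodes_point.
have [p [q [b [u [v [[pq ap pp pv] [bp bq ->]]]]]]] := parking_split pu.
have [|alpha Ea] := IH p _ u pp; first by lia.
have [|beta Eb] := IH q _ v pv; first by lia.
by eexists; apply: encodes_cone Ea Eb bp bq.
Qed.

Lemma encodes_case1 n omega u : encodes n omega u ->
  encodes n.+1 (cone n.+1 [seq graft cherry 1 w | w <- omega])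
          (1 :: [seq 1 + x | x <- u]).
Proof.
move=> E; have [sz _ _ _] := encodes_generic E.
have su := parking_size (encodes_parking E).
have b0 : count id (nseq n false) = 0 by rewrite count_nseq.
have bn : count negb (nseq n false) = n by rewrite count_nseq mul1n.
rewrite -(@product_point (nseq n false)) ?bn //.
rewrite -[X in 1 :: X](@interleave_nill _ (nseq n false)) ?size_map ?bn //.
exact: encodes_cone encodes_point E b0 bn.
Qed.

Lemma encodes_case2 a p q alpha beta theta u v :
  1 <= a <= p.+1 -> encodes p alpha u -> encodes q beta v ->
  shuffle p q theta ->
  encodes (p + q).+1 (cone (p + q).+1 (product_simplex a p alpha beta theta))
    (a :: shuffle_act theta (u ++ [seq p + 1 + x | x <- v])).
Proof.
move=> ap Eu Ev sh; have [bp bq ->] := shuffleE sh.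
have [_ eb] := shuffle_ofP bp bq.
rewrite product_simplexE eb (shuffle_act_interleave (q := q)); last first.
- by rewrite size_map (parking_size (encodes_parking Ev)).
- by rewrite (parking_size (encodes_parking Eu)).
by rewrite addn1; apply: encodes_cone Eu Ev bp bq.
Qed.

Lemma simplex_encodes n s : simplex n s -> exists u, encodes n s u.
Proof.
elim=> {n s} [|n omega _ [u Eu]
  |a p q alpha beta theta _ ap _ [u Eu] _ [v Ev] sh].
- by exists [::]; exact: encodes_point.
- by eexists; exact: encodes_case1 Eu.
- by eexists; exact: encodes_case2 Eu Ev sh.
Qed.

Lemma encodes_simplex n s u : encodes n s u -> simplex n s.
Proof.
elim=> {n s u} [|n a p q b alpha beta u v <- ap Eu Sa Ev Sb bp bq].
  exact: simplex_point.
have [p0|p0] := posnP p; last first.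
  have [sh eb] := shuffle_ofP bp bq.
  by rewrite -eb -product_simplexE; exact: simplex_case2.
move: ap Eu bp; rewrite p0 => a1 Eu bp.
have {a1}-> : a = 1 by lia.
inversion Eu; subst alpha u.
have [sz _ _ _] := encodes_generic Ev.
rewrite product_point ?bq //; exact: simplex_case1.
Qed.

(** The recursion leaves no choice: its two cases cover the rule of [encodes]
    for p = 0 and for p > 0. *)
Lemma Phi_encodes Phi n s u : Phi_recursion Phi -> encodes n s u -> Phi n s = u.
Proof.
move=> PhiR; elim=> {n s u} [|n a p q b alpha beta u v <- ap Eu Ia Ev Ib bp bq].
  exact: Phi_point PhiR.
have Sa := encodes_simplex Eu; have Sb := encodes_simplex Ev.
have [p0|p0] := posnP p; last first.
  have [sh eb] := shuffle_ofP bp bq.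
  rewrite -{1}eb -product_simplexE (Phi_case2 PhiR) // Ia Ib addn1.
  rewrite (shuffle_act_interleave (q := q)) //.
    by rewrite (parking_size (encodes_parking Eu)).
  by rewrite size_map (parking_size (encodes_parking Ev)).
move: ap Eu bp Sa Ia; rewrite p0 => a1 Eu bp _ _.
have {a1}-> : a = 1 by lia.
inversion Eu; subst alpha u.
have [sz _ _ _] := encodes_generic Ev.
rewrite product_point ?bq // (Phi_case1 PhiR) // Ib.
rewrite interleave_nill ?size_map //.
by rewrite (parking_size (encodes_parking Ev)).
Qed.

Theorem theorem3p4 :
  (exists Phi : nat -> seq tree -> seq nat, Phi_recursion Phi) /\
  (forall Phi : nat -> seq tree -> seq nat, Phi_recursion Phi ->
     forall n : nat, (1 <= n)%N ->
       set_bij (triangulation n) (PF n) (Phi n)).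
Proof.
split.
  (* Unique decomposition of simplices makes the recursion consistent: the
     encoding itself is a solution. *)
  pose Phi n s : seq nat := xget [::] [set u | encodes n s u]%classic.
  have PhiE n s u : encodes n s u -> Phi n s = u.
    move=> E; apply: (encodes_fun (n := n) (s := s)) => //.
    exact: (@xgetI _ [::] [set u | encodes n s u]%classic u).
  exists Phi; split.
  - exact/PhiE/encodes_point.
  - move=> n omega /simplex_encodes[u Eu].
    by rewrite (PhiE _ _ _ Eu); apply/PhiE/encodes_case1.
  - move=> a p q alpha beta theta _ ap /simplex_encodes[u Eu].
    move=> /simplex_encodes[v Ev] sh.
    by rewrite (PhiE _ _ _ Eu) (PhiE _ _ _ Ev); apply/PhiE/encodes_case2.
move=> Phi PhiR n _; split.
- move=> s /simplex_encodes[u Eu]; rewrite (Phi_encodes PhiR Eu).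
  exact: encodes_parking Eu.
- move=> s s' /set_mem/simplex_encodes[u Eu] /set_mem/simplex_encodes[u' Eu'].
  rewrite (Phi_encodes PhiR Eu) (Phi_encodes PhiR Eu') => uu.
  by apply: encodes_inj Eu _; rewrite uu.
- move=> u /parking_encodes[s Es]; exists s; first exact: encodes_simplex Es.
  exact: Phi_encodes.
Qed.
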